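(* Let $a_1,\dots,a_s\in\mathbb Z_{>0}$, $e_1,\dots,e_s\in\mathbb Z$, let $R$ be a rational function, and let $\mathcal G(x)=R(x)\prod_{i=1}^s\Gamma(a_ix)^{e_i}$. For every positive integer $n$ and $u$ near zero, $$\mathcal G(n+u)=C_{\mathcal G}(u)\,K_{\mathcal G}(n,u),$$ where $$C_{\mathcal G}(u)=\prod_{i=1}^s\Gamma(1+a_iu)^{e_i},\qquad K_{\mathcal G}(n,u)=R(n+u)\prod_{i=1}^s\left(\frac{(1+a_iu)_{a_in}}{a_i(n+u)}\right)^{e_i}.$$ If moreover the quotient is balanced, i.e. $\chi_1=\sum_{i=1}^se_ia_i=0$, then for $u$ near zero $$\log C_{\mathcal G}(u)=\sum_{m=2}^{\infty}(-1)^m\frac{\chi_m}{m}\zeta(m)u^m .$$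
   Context: $(z)_k=z(z+1)\cdots(z+k-1)$ is the rising factorial, $(z)_0=1$. The characteristic power sums are $\chi_m=\sum_{i=1}^se_ia_i^m$ for $m\ge1$. $\zeta$ is the Riemann zeta function. The first identity is an identity of meromorphic functions of $u$ near $0$ (if $R$ has a pole at $n$); $\log C_{\mathcal G}$ is the branch vanishing at $u=0$. *)

(* Defs.v *)
From HB Require Import structures.
From mathcomp Require Import all_boot all_order all_algebra.
From mathcomp Require Import all_classical all_reals all_analysis.
From mathcomp Require Import complex.
Set Implicit Arguments.
Unset Strict Implicit.
Unset Printing Implicit Defensive.
Import Order.TTheory GRing.Theory Num.Theory.
Import numFieldNormedType.Exports.
Local Open Scope classical_set_scope.
Local Open Scope ring_scope.
Local Open Scope complex_scope.

(* The libraries put the usual topology and norm only on the alias R[i]^o;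
   as they do for abstract number fields, transfer them to R[i] itself. *)
HB.instance Definition _ (R : rcfType) :=
  PseudoPointedMetric.copy R[i] R[i]^o.
HB.instance Definition _ (R : rcfType) :=
  GRing.ComAlgebra.copy R[i] R[i]^o.
HB.instance Definition _ (R : rcfType) := Vector.copy R[i] R[i]^o.
HB.instance Definition _ (R : rcfType) := NormedModule.copy R[i] R[i]^o.

Section SpecialFunctions.
Variable R : realType.
Implicit Types (z : R[i]) (k m N : nat).

Definition cexp z : R[i] :=
  (expR (complex.Re z) * cos (complex.Im z))
    +i* (expR (complex.Re z) * sin (complex.Im z)).

(* N ^ z for N > 0 *)
Definition cpow_nat N z : R[i] := cexp (z * (ln (N%:R : R))%:C).

Definition rising z k : R[i] := \prod_(j < k) (z + j%:R).

(* Gauss's limit  N! N^z / (z (z + 1) ... (z + N)),  which gives Gamma on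
   the whole plane minus its poles 0, -1, -2, ...; at the poles the terms
   are eventually 0 because x / 0 = 0, so the (junk) value there is 0. *)
Definition Gamma z : R[i] :=
  limn (fun N => (N`!)%:R * cpow_nat N z / rising z N.+1).

(* Only meaningful for m >= 2; riemannR s k is 1 / (k + 1) ^ s. *)
Definition zeta m : R := limn (series (riemannR (m%:R : R))).

(* L represents, near 0, the branch of log f vanishing at 0. *)
Definition log_branch0 (L f : R[i] -> R[i]) : Prop :=
  [/\ L 0 = 0,
      \forall u \near (0 : R[i]), {for u, continuous L} &
      \forall u \near (0 : R[i]), cexp (L u) = f u].

End SpecialFunctions.

Section GammaQuotient.
Variables (R : realType) (s : nat) (a : 'I_s -> nat) (e : 'I_s -> int).

Definition chi (m : nat) : int := \sum_(i < s) e i * (a i)%:Z ^+ m.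

(* The rational function is p / q. *)
Definition gamma_quotient (p q : {poly R[i]}) (x : R[i]) : R[i] :=
  p.[x] / q.[x] * \prod_(i < s) Gamma ((a i)%:R * x) ^ e i.

Definition C_G (u : R[i]) : R[i] :=
  \prod_(i < s) Gamma (1 + (a i)%:R * u) ^ e i.

Definition K_G (p q : {poly R[i]}) (n : nat) (u : R[i]) : R[i] :=
  p.[n%:R + u] / q.[n%:R + u] *
  \prod_(i < s)
    (rising (1 + (a i)%:R * u) (a i * n) / ((a i)%:R * (n%:R + u))) ^ e i.

End GammaQuotient.

(* Main.v *)
Require Import Defs.
From HB Require Import structures.
From mathcomp Require Import all_boot all_order all_algebra.
From mathcomp Require Import all_classical all_reals all_analysis.
From mathcomp Require Import complex.
From mathcomp Require Import ring lra.
Import Order.TTheory GRing.Theory Num.Theory.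
Import numFieldNormedType.Exports.
Local Open Scope classical_set_scope.
Local Open Scope ring_scope.
Local Open Scope complex_scope.
Set Implicit Arguments.
Unset Strict Implicit.
Unset Printing Implicit Defensive.

(** The factorization is the functional equation of Gamma: since
    a (n + u) = (1 + a u) + (a n - 1) for positive integers a and n, one has
    Gamma (a (n + u)) = (1 + a u)_(a n - 1) Gamma (1 + a u), and the missing
    last factor of (1 + a u)_(a n) is a (n + u) itself. For the Gauss limit the
    functional equation is a one-line identity between the N-th terms at z and
    at z + 1 ([gauss_term_succ]), but it transfers to the limit only once the
    limit is known to exist.

    Existence of the limit and the expansion of log C come from one
    computation. For |z| <= 1/2 let Log (1 + z) be the principal logarithm. The
    N-th Gauss term at 1 + z is, up to a factor tending to 1,

      exp (- z (H_N - ln N) + sum_(k <= N) (z / k - Log (1 + z / k))),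

    where H_N is the N-th harmonic number ([gauss_term_exp]). The first summand
    tends to - gamma z. The second one converges absolutely because
    z / k - Log (1 + z / k) is of order 1 / k^2, so
    Gamma (1 + z) = exp (- gamma z + T z) with T the limit [lgamma_tail]. In a
    balanced quotient the gamma terms add up to - gamma chi_1 u = 0, hence
    log C u = sum_i e_i T (a_i u).

    The power series of T is obtained without exchanging infinite sums: Taylor's
    formula for Log with a remainder bounded by 4 |z|^M
    ([clog1p_taylor]) is summed over k <= N; letting N tend to infinity turns
    the sums of k^(-m) into zeta m and gives
    |T z - sum_(2 <= m < M) (-1)^m (zeta m / m) z^m| <= 8 |z|^M
    ([lgamma_tail_approx]). This bound yields both the convergence of the series
    and the continuity of T. Any other branch vanishing at 0 agrees with this
    one near 0, because the only logarithm of 1 with imaginary part at most 1 in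
    absolute value is 0. *)

Local Notation normc := Normc.normc.

(** * Modulus, limits and exponential of complex numbers *)

Section ComplexNorm.
Variable R : realType.
Implicit Types z w : R[i].

Lemma normcE z : `|z| = (normc z)%:C.
Proof. by case: z. Qed.

Lemma normc_ge0 z : 0 <= normc z.
Proof. by case: z => a b; exact: sqrtr_ge0. Qed.

Lemma normcR (x : R) : normc x%:C = `|x|.
Proof. by rewrite /= expr0n addr0 sqrtr_sqr. Qed.

Lemma normc_triangle z w : normc (z + w) <= normc z + normc w.
Proof. exact: le_normcD. Qed.

Lemma normc_sum (I : Type) (r : seq I) (P : pred I) (f : I -> R[i]) :
  normc (\sum_(i <- r | P i) f i) <= \sum_(i <- r | P i) normc (f i).
Proof.
elim/big_ind2: _ => [|x1 x2 y1 y2 h1 h2|//]; first by rewrite Normc.normc0.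
exact: (le_trans (normc_triangle _ _)) (lerD h1 h2).
Qed.

Lemma normcX z n : normc (z ^+ n) = normc z ^+ n.
Proof.
by elim: n => [|n ih]; rewrite ?expr0 ?Normc.normc1// !exprS Normc.normcM ih.
Qed.

Lemma normr_Re_le z : `|complex.Re z| <= normc z.
Proof.
case: z => a b /=; rewrite -sqrtr_sqr ler_wsqrtr//.
by rewrite lerDl sqr_ge0.
Qed.

Lemma normr_Im_le z : `|complex.Im z| <= normc z.
Proof.
case: z => a b /=; rewrite -sqrtr_sqr ler_wsqrtr//.
by rewrite lerDr sqr_ge0.
Qed.

Lemma normc_le_ReIm z : normc z <= `|complex.Re z| + `|complex.Im z|.
Proof.
case: z => a b /=.
rewrite -(ler_pXn2r (n := 2))// ?nnegrE ?sqrtr_ge0 ?addr_ge0//.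
rewrite sqr_sqrtr ?addr_ge0 ?sqr_ge0// sqrrD !real_normK ?num_real//.
by rewrite lerD2r lerDl mulrn_wge0// mulr_ge0.
Qed.

Lemma ReB z w : complex.Re (z - w) = complex.Re z - complex.Re w.
Proof. by case: z; case: w. Qed.
Lemma ImB z w : complex.Im (z - w) = complex.Im z - complex.Im w.
Proof. by case: z; case: w. Qed.
Lemma ReD z w : complex.Re (z + w) = complex.Re z + complex.Re w.
Proof. by case: z; case: w. Qed.
Lemma ImD z w : complex.Im (z + w) = complex.Im z + complex.Im w.
Proof. by case: z; case: w. Qed.

Lemma Re_sum (I : Type) (r : seq I) (P : pred I) (f : I -> R[i]) :
  complex.Re (\sum_(i <- r | P i) f i) = \sum_(i <- r | P i) complex.Re (f i).
Proof. exact: (big_morph _ ReD). Qed.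
Lemma Im_sum (I : Type) (r : seq I) (P : pred I) (f : I -> R[i]) :
  complex.Im (\sum_(i <- r | P i) f i) = \sum_(i <- r | P i) complex.Im (f i).
Proof. exact: (big_morph _ ImD). Qed.

Section Limits.
Context {T : Type} {F : set_system T} {FF : ProperFilter F}.
Implicit Types (f : T -> R[i]) (l : R[i]).

(** Distances in [R[i]] take values in [R[i]] itself; this brings the epsilons
    down to the ordered field [R], where [lra] applies. *)
Lemma cvg_normcP f l : f @ F --> l <->
  forall e : R, 0 < e -> \forall x \near F, normc (l - f x) <= e.
Proof.
split.
  move=> /cvgrPdist_le h e e0.
  have e0' : 0 < e%:C by rewrite ltcR.
  move: (h _ e0'); apply: filterS => x; by rewrite normcE lecR.
move=> h; apply/cvgrPdist_le => e e0.
have [e0' eE] : 0 < complex.Re e /\ e = (complex.Re e)%:C.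
  by move: e0; rewrite ltcE => /andP[/eqP /= h1 h2]; split => //; case: e h1 h2 => a b /= ->.
rewrite eE; move: (h _ e0'); apply: filterS => x; by rewrite normcE lecR.
Qed.

Lemma cvg_Re f l : f @ F --> l -> (fun x => complex.Re (f x)) @ F --> complex.Re l.
Proof.
move=> /cvg_normcP h; apply/cvgrPdist_le => e e0.
move: (h _ e0); apply: filterS => x; rewrite -ReB.
exact: le_trans (normr_Re_le _).
Qed.

Lemma cvg_Im f l : f @ F --> l -> (fun x => complex.Im (f x)) @ F --> complex.Im l.
Proof.
move=> /cvg_normcP h; apply/cvgrPdist_le => e e0.
move: (h _ e0); apply: filterS => x; rewrite -ImB.
exact: le_trans (normr_Im_le _).
Qed.

Lemma cvg_complex (f : T -> R[i]) l : (fun x => complex.Re (f x)) @ F --> complex.Re l ->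
  (fun x => complex.Im (f x)) @ F --> complex.Im l -> f @ F --> l.
Proof.
move=> /cvgrPdist_le h1 /cvgrPdist_le h2; apply/cvg_normcP => e e0.
have e2 : 0 < e / 2 by rewrite divr_gt0.
move: (h1 _ e2) (h2 _ e2); apply: filterS2 => x; rewrite -ReB -ImB => a b.
apply: le_trans (normc_le_ReIm _) _; lra.
Qed.

Lemma cvgC_cst l : (fun=> l) @ F --> l.
Proof. exact: (@cvg_cst R[i]^o). Qed.

Lemma cvgC_D f g l m : f @ F --> l -> g @ F --> m -> (fun x => f x + g x) @ F --> l + m.
Proof. move=> fa fb; exact: (@cvgD R[i]^o R[i]^o _ _ _ f g l m fa fb). Qed.

Lemma cvgC_M f g l m : f @ F --> l -> g @ F --> m -> (fun x => f x * g x) @ F --> l * m.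
Proof. move=> fa fb; exact: (@cvgM R[i]^o _ _ _ f g l m fa fb). Qed.

Lemma cvgC_sum (I : Type) (r : seq I) (f : I -> T -> R[i]) (l : I -> R[i]) :
  (forall i, f i @ F --> l i) ->
  (fun x => \sum_(i <- r) f i x) @ F --> \sum_(i <- r) l i.
Proof.
move=> fl; elim: r => [|i r ih].
  rewrite big_nil; under eq_fun do rewrite big_nil; exact: cvgC_cst.
rewrite big_cons; under eq_fun do rewrite big_cons; exact: cvgC_D (fl i) ih.
Qed.

Lemma cvgC_real (f : T -> R) (l : R) : f @ F --> l -> (fun x => (f x)%:C) @ F --> l%:C.
Proof. move=> fl; apply: cvg_complex => /=; [exact: fl | exact: cvg_cst]. Qed.

Lemma cvg_normc_le f l (c : R) : f @ F --> l -> (\forall x \near F, normc (f x) <= c) ->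
  normc l <= c.
Proof.
move=> /cvg_normcP fl fc; apply/ler_addgt0Pl => e e0.
have [x [h1 h2]] := filter_ex (filterI (fl _ e0) fc).
rewrite -[l](subrK (f x)); apply: le_trans (normc_triangle _ _) _.
exact: lerD.
Qed.

Lemma cvgC_cexp f l : f @ F --> l -> (fun x => cexp (f x)) @ F --> cexp l.
Proof.
move=> fl; have h1 := cvg_Re fl; have h2 := cvg_Im fl.
apply: cvg_complex => /=; apply: cvgM.
- by apply: continuous_cvg h1; exact: continuous_expR.
- by apply: continuous_cvg h2; exact: continuous_cos.
- by apply: continuous_cvg h1; exact: continuous_expR.
- by apply: continuous_cvg h2; exact: continuous_sin.
Qed.

End Limits.

Lemma cvgC_lim (f : nat -> R[i]) (l : R[i]) : f @ \oo --> l -> limn f = l.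
Proof. move=> fl; exact: (@cvg_lim R[i]^o (@norm_hausdorff _ R[i]^o) _ _ _ _ _ fl). Qed.

Lemma near0_normc (e : R) : 0 < e -> \forall u \near (0 : R[i]), normc u <= e.
Proof.
have h : (fun u : R[i] => u) @ (0 : R[i]) --> (0 : R[i]) by exact: cvg_id.
move=> e0; move/cvg_normcP : h => /(_ _ e0); apply: filterS => u.
by rewrite sub0r normcN.
Qed.

Lemma cexpD z w : cexp (z + w) = cexp z * cexp w.
Proof.
case: z => a b; case: w => c d; rewrite /cexp /= expRD cosD sinD.
by apply/eqP; rewrite eq_complex /=; apply/andP; split; apply/eqP; ring.
Qed.

Lemma cexp0 : cexp (0 : R[i]) = 1.
Proof. by rewrite /cexp /= expR0 cos0 sin0 mulr1 mulr0. Qed.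

Lemma cexp_neq0 z : cexp z != 0.
Proof.
apply/eqP => z0; have := cexpD (- z) z.
by rewrite addNr cexp0 z0 mulr0 => /eqP; rewrite oner_eq0.
Qed.

Lemma cexpN z : cexp (- z) = (cexp z)^-1.
Proof.
apply: (mulIf (cexp_neq0 z)).
by rewrite -cexpD addNr cexp0 mulVf// cexp_neq0.
Qed.

Lemma cexp_sum (I : Type) (r : seq I) (f : I -> R[i]) :
  cexp (\sum_(i <- r) f i) = \prod_(i <- r) cexp (f i).
Proof. exact: (big_morph _ cexpD cexp0). Qed.

Lemma cexpMn z n : cexp (z *+ n) = cexp z ^+ n.
Proof. by elim: n => [|n ih]; rewrite ?mulr0n ?cexp0// mulrSr cexpD ih exprSr. Qed.

Lemma cexpMz z (n : int) : cexp (z *~ n) = cexp z ^ n.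
Proof. by case: n => n; rewrite ?cexpMn// NegzE mulrNz cexpN cexpMn exprnN. Qed.

(** The periods of the exponential lie on the imaginary axis, at distance more
    than 1 from 0. *)
Lemma cexp_eq1 z : cexp z = 1 -> `|complex.Im z| <= 1 -> z = 0.
Proof.
case: z => x y /= [] h1 h2 y1.
have E0 : expR x != 0 by rewrite gt_eqF ?expR_gt0.
have s0 : sin y = 0 by move/eqP: h2; rewrite mulf_eq0 (negbTE E0) => /eqP.
have y0 : y = 0.
  apply: sin_inj; rewrite ?sin0 ?s0// in_itv /=; have := pihalf_ge1 R;
  have := ler_norml y 1; rewrite y1 => /esym/andP[]; lra.
move: h1; rewrite y0 cos0 mulr1 -expR0 => /expR_inj ->; by [].
Qed.
End ComplexNorm.

(** * Taylor's formula for the principal logarithm *)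

Section Log.
Variable R : realType.
Implicit Types z w : R[i].

(** The principal branch of log (1 + z) on the half plane Re z > -1. Its real
    part ln |1 + z| is written with the squared modulus so that it can be
    differentiated along rays. *)
Definition clog1p z : R[i] :=
  (ln ((1 + complex.Re z) ^+ 2 + complex.Im z ^+ 2) / 2)
    +i* atan (complex.Im z / (1 + complex.Re z)).

Lemma is_derive_addf (f g : R -> R) (x a b : R) : is_derive x 1 f a ->
  is_derive x 1 g b -> is_derive x 1 (fun t => f t + g t) (a + b).
Proof. exact: is_deriveD. Qed.

Lemma is_derive_scalef (c : R) (f : R -> R) (x a : R) : is_derive x 1 f a ->
  is_derive x 1 (fun t => c * f t) (c * a).
Proof. move=> h; exact: (is_deriveZ c h). Qed.

Lemma is_derive_expf n (f : R -> R) (x a : R) : is_derive x 1 f a ->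
  is_derive x 1 (fun t => f t ^+ n) (n%:R * f x ^+ n.-1 * a).
Proof.
move=> h; rewrite (_ : (fun t => _) = f ^+ n); first exact: is_deriveX.
by apply/funext => t; rewrite exprfctE.
Qed.

Lemma is_derive_affine (a b x : R) : is_derive x 1 (fun t => a + b * t) b.
Proof.
rewrite -{2}[b]add0r -{2}[b]mulr1.
by apply: is_derive_addf.
Qed.

Lemma is_derive_lnf (f : R -> R) (x a : R) : 0 < f x -> is_derive x 1 f a ->
  is_derive x 1 (fun t => ln (f t)) ((f x)^-1 * a).
Proof. by move=> fx0 h; exact: (is_derive1_comp (is_derive1_ln fx0) h). Qed.

Lemma is_derive_atanf (f : R -> R) (x a : R) : is_derive x 1 f a ->
  is_derive x 1 (fun t => atan (f t)) ((1 + f x ^+ 2)^-1 * a).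
Proof. by move=> h; exact: (is_derive1_comp (is_derive1_atan (f x)) h). Qed.

Lemma is_derive_divf (f g : R -> R) (x a b : R) : g x != 0 ->
  is_derive x 1 f a -> is_derive x 1 g b ->
  is_derive x 1 (fun t => f t / g t) ((a * g x - f x * b) / g x ^+ 2).
Proof.
move=> gx0 hf hg; have h := is_deriveM hf (is_deriveV gx0 hg).
apply: is_derive_eq; rewrite /GRing.scale /=; field.
exact: gx0.
Qed.

Lemma is_derive_powers (r : nat -> R) n (t : R) :
  is_derive t 1 (fun x => \sum_(m < n) r m / m.+1%:R * x ^+ m.+1)
    (\sum_(m < n) r m * t ^+ m).
Proof.
elim: n => [|n ih].
  rewrite big_ord0; under eq_fun do rewrite big_ord0; exact: is_derive_cst.
rewrite big_ord_recr/=; under eq_fun do rewrite big_ord_recr/=.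
apply: is_derive_addf => //.
have -> : r n * t ^+ n = r n / n.+1%:R * (n.+1%:R * t ^+ n * 1).
  by field.
exact: (is_derive_scalef (r n / n.+1%:R) (is_derive_expf n.+1 (is_derive_id t 1))).
Qed.

(** The derivatives of the two components of log (1 + t z), for z = x + i y, are
    those of z / (1 + t z). *)
Lemma is_derive_Re_clog1p_ray (x y t : R) : 0 < 1 + x * t ->
  is_derive t 1 (fun t => ln ((1 + x * t) ^+ 2 + (y * t) ^+ 2) / 2)
   ((x * (1 + x * t) + t * y ^+ 2) / ((1 + x * t) ^+ 2 + (y * t) ^+ 2)).
Proof.
move=> h.
have r0 : 0 < (1 + x * t) ^+ 2 + (y * t) ^+ 2.
  by rewrite ltr_pwDl ?exprn_gt0 ?sqr_ge0.
have dy : is_derive t 1 (fun t => y * t) y.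
  by rewrite -{2}[y]mulr1; apply: is_derive_scalef; exact: is_derive_id.
have d1 := is_derive_addf (is_derive_expf 2 (is_derive_affine 1 x t)) (is_derive_expf 2 dy).
have d2 := is_derive_scalef 2^-1 (@is_derive_lnf (fun t => (1 + x * t) ^+ 2 + (y * t) ^+ 2) _ _ r0 d1).
move: d2; rewrite (_ : (fun t0 => 2^-1 * _) = (fun t => ln ((1 + x * t) ^+ 2 + (y * t) ^+ 2) / 2)); last first.
  by apply/funext => u; rewrite mulrC.
rewrite (_ : 2^-1 * _ = ((x * (1 + x * t) + t * y ^+ 2) / ((1 + x * t) ^+ 2 + (y * t) ^+ 2))) //=.
by field; rewrite gt_eqF.
Qed.

Lemma is_derive_Im_clog1p_ray (x y t : R) : 0 < 1 + x * t ->
  is_derive t 1 (fun t => atan (y * t / (1 + x * t)))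
   (y / ((1 + x * t) ^+ 2 + (y * t) ^+ 2)).
Proof.
move=> h.
have r0 : 0 < (1 + x * t) ^+ 2 + (y * t) ^+ 2.
  by rewrite ltr_pwDl ?exprn_gt0 ?sqr_ge0.
have h0 : 1 + x * t != 0 by rewrite gt_eqF.
have dy : is_derive t 1 (fun t => y * t) y.
  by rewrite -{2}[y]mulr1; apply: is_derive_scalef; exact: is_derive_id.
have d2 := @is_derive_atanf (fun t => y * t / (1 + x * t)) _ _ (@is_derive_divf (fun t => y * t) (fun t => 1 + x * t) _ _ _ h0 dy (is_derive_affine 1 x t)).
apply: is_derive_eq.
field; rewrite h0 /= ?gt_eqF//.
Qed.

Lemma cexp_clog1p z : -1 < complex.Re z -> cexp (clog1p z) = 1 + z.
Proof.
case: z => x y /= x1; rewrite /cexp /clog1p /=.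
have X0 : 0 < 1 + x by lra.
set r := (1 + x) ^+ 2 + y ^+ 2; set t := y / (1 + x).
have r0 : 0 < r by rewrite ltr_pwDl ?exprn_gt0 ?sqr_ge0.
set E := expR _; have E0 : 0 < E by exact: expR_gt0.
have E2 : E ^+ 2 = r.
  by rewrite expr2 /E -expRD -splitr lnK.
have c0 : 0 < cos (atan t).
  by apply: cos_gt0_pihalf; rewrite atan_gtNpi2 atan_ltpi2.
have cV : (cos (atan t)) ^- 2 = 1 + t ^+ 2 by rewrite cos2_tan2 ?atanK ?gt_eqF.
have sE : sin (atan t) = t * cos (atan t).
  by rewrite -{2}(atanK t) /tan divfK// gt_eqF.
have Ec : E * cos (atan t) = 1 + x.
  have t2 : r = (1 + t ^+ 2) * (1 + x) ^+ 2 by rewrite /r /t; field; lra.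
  apply/eqP; rewrite -(eqrXn2 (n := 2))// ?mulr_ge0 ?ltW// exprMn E2 t2 -cV.
  by apply/eqP; field; rewrite gt_eqF.
apply/eqP; rewrite eq_complex /= sE; apply/andP; split; apply/eqP; first exact: Ec.
by rewrite mulrCA Ec /t add0r divfK// gt_eqF.
Qed.

Lemma ReMr (c : R) z : complex.Re (z * c%:C) = complex.Re z * c.
Proof. by case: z => a b /=; rewrite mulr0 subr0. Qed.
Lemma ImMr (c : R) z : complex.Im (z * c%:C) = complex.Im z * c.
Proof. by case: z => a b /=; rewrite mulr0 add0r. Qed.

Lemma divcE z w : z / w =
  ((complex.Re z * complex.Re w + complex.Im z * complex.Im w)
     / (complex.Re w ^+ 2 + complex.Im w ^+ 2))
  +i* ((complex.Im z * complex.Re w - complex.Re z * complex.Im w)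
     / (complex.Re w ^+ 2 + complex.Im w ^+ 2)).
Proof.
case: z => a b; case: w => c d; apply/eqP; rewrite eq_complex /=.
by apply/andP; split; apply/eqP; ring.
Qed.

(** The mean value theorem has no complex-valued form, so remainders are bounded
    one component at a time. *)
Lemma mvt_bound (f df : R -> R) (c : R) :
  (forall t : R, 0 <= t <= 1 -> is_derive t 1 f (df t)) ->
  (forall t : R, 0 <= t <= 1 -> `|df t| <= c) -> `|f 1 - f 0| <= c.
Proof.
move=> fdf dfc.
have [t||t t01 ->] := @MVT_segment R f df 0 1 ler01.
- by rewrite in_itv /= => /andP[t0 t1]; apply: fdf; rewrite !ltW.
- apply: derivable_within_continuous => t; rewrite in_itv /= => t01.
  by have := fdf _ t01 => ?; exact: ex_derive.
- by rewrite subr0 mulr1; apply: dfc; move: t01; rewrite in_itv.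
Qed.

Definition log_partial_sum z n : R[i] := \sum_(m < n) (-1) ^+ m * z ^+ m.+1 / m.+1%:R.

Section Ray.
Variables (z : R[i]) (n : nat).
Hypothesis z2 : normc z <= 1/2.

(** The derivative in t of log (1 + t z) minus the n-th partial sum of its
    series at t z. *)
Let dlog (t : R) := z / (1 + z * t%:C) - \sum_(m < n) (z * (- z) ^+ m) * (t ^+ m)%:C.

Let re_pos (t : R) : 0 <= t <= 1 -> 1/2 <= 1 + complex.Re z * t.
Proof.
move=> /andP[t0 t1]; have := le_trans (normr_Re_le z) z2.
rewrite ler_norml => /andP[h1 h2]; nra.
Qed.

(** By the geometric series, [dlog t] is z (- t z)^n / (1 + t z), and
    |1 + t z| >= 1/2. *)
Let dlog_le (t : R) : 0 <= t <= 1 -> normc (dlog t) <= 2 * normc z ^+ n.+1.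
Proof.
move=> t01; have h := re_pos t01; move: (t01) => /andP[t0 t1].
set w := z * t%:C.
have nw : 1/2 <= normc (1 + w).
  apply: le_trans h _; rewrite -[leRHS]/(normc (1 + w)).
  apply: le_trans (normr_Re_le _); rewrite ReD ReMr /=; exact: ler_norm.
have w0 : 1 + w != 0.
  by apply/eqP => w0; move: nw; rewrite w0 Normc.normc0; lra.
have -> : dlog t = z * (- w) ^+ n / (1 + w).
  rewrite /dlog -/w.
  have -> : \sum_(m < n) z * (- z) ^+ m * (t ^+ m)%:C = z * \sum_(m < n) (- w) ^+ m.
    rewrite mulr_sumr; apply: eq_bigr => m _.
    by rewrite -mulrA /w -mulNr exprMn rmorphXn.
  have := subrX1 (- w) n; move: (\sum_(m < n) _) ((- w) ^+ n) => S W.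
  have w1 : - w - 1 != 0 by rewrite -opprD oppr_eq0 addrC.
  move=> hS; have -> : S = (W - 1) / (- w - 1) by rewrite hS mulrC mulKf.
  field; rewrite w0 w1; by [].
rewrite !Normc.normcM Normc.normcV normcX normcN /w Normc.normcM normcR.
rewrite ger0_norm//.
have nz := normc_ge0 z.
have zt : (normc z * t) ^+ n <= normc z ^+ n.
  by apply: lerXn2r; rewrite ?nnegrE ?mulr_ge0// ler_piMr.
have nV : (normc (1 + w))^-1 <= 2 by rewrite -[leRHS]invrK lef_pV2 ?posrE; lra.
rewrite exprS mulrC; apply: ler_pM => //; last exact: ler_wpM2l.
- by rewrite invr_ge0 normc_ge0.
- by rewrite mulr_ge0// exprn_ge0// mulr_ge0.
Qed.

(** Each component of the remainder vanishes at t = 0 on the ray from 0 to z and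
    has derivative bounded by [dlog_le]; adding the two components doubles the
    constant. *)
Lemma clog1p_taylor : normc (clog1p z - log_partial_sum z n) <= 4 * normc z ^+ n.+1.
Proof.
pose c m : R[i] := z * (- z) ^+ m.
have polyE (P : R[i] -> R) (P0 : P = @complex.Re R \/ P = @complex.Im R) :
   P (log_partial_sum z n) = \sum_(m < n) P (c m) / m.+1%:R * 1 ^+ m.+1.
  have -> : P (log_partial_sum z n) = \sum_(m < n) P ((-1) ^+ m * z ^+ m.+1 / m.+1%:R).
    by case: P0 => ->; rewrite ?Re_sum ?Im_sum.
  apply: eq_bigr => m _; rewrite expr1n mulr1.
  have -> : (-1) ^+ m * z ^+ m.+1 / m.+1%:R = c m * (m.+1%:R^-1 : R)%:C.
    by rewrite fmorphV rmorph_nat /c [(- z) ^+ m]exprNn exprS mulrCA.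
  by case: P0 => ->; rewrite ?ReMr ?ImMr.
have hRe : `|complex.Re (clog1p z - log_partial_sum z n)| <= 2 * normc z ^+ n.+1.
  pose f (t : R) := ln ((1 + complex.Re z * t) ^+ 2 + (complex.Im z * t) ^+ 2) / 2
     - \sum_(m < n) complex.Re (c m) / m.+1%:R * t ^+ m.+1.
  have -> : complex.Re (clog1p z - log_partial_sum z n) = f 1 - f 0.
    rewrite ReB (polyE _ (or_introl erefl)) /f !mulr1 !mulr0 addr0 expr0n addr0 expr1n ln1 mul0r.
    rewrite [X in _ = _ - (_ - X)]big1 ?subrr ?subr0// => m _.
    by rewrite expr0n mulr0.
  apply: (@mvt_bound _ (fun t => complex.Re (dlog t))) => t t01; last first.
    exact: le_trans (normr_Re_le _) (dlog_le t01).
  have h := re_pos t01.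
  have h0 : 0 < 1 + complex.Re z * t by lra.
  have := is_deriveB (is_derive_Re_clog1p_ray (complex.Im z) h0)
     (is_derive_powers (fun m => complex.Re (c m)) n t).
  congr (is_derive _ _ _ _).
  rewrite /dlog ReB Re_sum divcE /= !ReD !ImD !ReMr !ImMr /= add0r.
  congr (_ / _ - _); first by ring.
  by apply: eq_bigr => m _; rewrite ReMr.
have hIm : `|complex.Im (clog1p z - log_partial_sum z n)| <= 2 * normc z ^+ n.+1.
  pose f (t : R) := atan (complex.Im z * t / (1 + complex.Re z * t))
     - \sum_(m < n) complex.Im (c m) / m.+1%:R * t ^+ m.+1.
  have -> : complex.Im (clog1p z - log_partial_sum z n) = f 1 - f 0.
    rewrite ImB (polyE _ (or_intror erefl)) /f !mulr1 !mulr0 mul0r atan0.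
    rewrite [X in _ = _ - (_ - X)]big1 ?subrr ?subr0// => m _.
    by rewrite expr0n mulr0.
  apply: (@mvt_bound _ (fun t => complex.Im (dlog t))) => t t01; last first.
    exact: le_trans (normr_Im_le _) (dlog_le t01).
  have h := re_pos t01.
  have h0 : 0 < 1 + complex.Re z * t by lra.
  have := is_deriveB (is_derive_Im_clog1p_ray (complex.Im z) h0)
     (is_derive_powers (fun m => complex.Im (c m)) n t).
  congr (is_derive _ _ _ _).
  rewrite /dlog ImB Im_sum divcE /= !ReD !ImD !ReMr !ImMr /= add0r.
  congr (_ / _ - _); first by ring.
  by apply: eq_bigr => m _; rewrite ImMr.
apply: le_trans (normc_le_ReIm _) _; lra.
Qed.
End Ray.

End Log.

(** * The logarithm of Gamma near 1, without its linear term *)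

Section Zeta.
Variable R : realType.
Implicit Types z w : R[i].

(** Telescoping: 1 / (k + 1)^2 <= 1 / k - 1 / (k + 1) for k >= 1. *)
Lemma sum_invsq_le2 N : \sum_(0 <= k < N) (k.+1%:R^-1 : R) ^+ 2 <= 2.
Proof.
suff h n : \sum_(0 <= k < n.+1) (k.+1%:R^-1 : R) ^+ 2 <= 2 - n.+1%:R^-1.
  case: N => [|n]; first by rewrite big_geq.
  by apply: le_trans (h n) _; rewrite gerBl invr_ge0.
elim: n => [|n ih]; first by rewrite big_nat1 invr1 expr1n; lra.
rewrite big_nat_recr//=; apply: le_trans (lerD ih (lexx _)) _.
rewrite -addrA lerD2l -subr_ge0.
have -> : - n.+2%:R^-1 - (- n.+1%:R^-1 + n.+2%:R^-1 ^+ 2) = (n.+1%:R * n.+2%:R ^+ 2)^-1 :> R.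
  by field; rewrite !gt_eqF // ltr_wpDr.
by rewrite invr_ge0 mulr_ge0// exprn_ge0.
Qed.

Lemma invn_exp_le m k : (2 <= m)%N -> (k.+1%:R^-1 : R) ^+ m <= (k.+1%:R^-1) ^+ 2.
Proof. by move=> m2; apply: ler_wiXn2l => //; rewrite ?invr_ge0// invf_le1// ler1n. Qed.

Lemma cvg_zeta m : (2 <= m)%N ->
  (fun N => \sum_(0 <= k < N) (k.+1%:R^-1 : R) ^+ m) @ \oo --> zeta R m.
Proof.
move=> m2; have E : riemannR (m%:R : R) = fun k => (k.+1%:R^-1 : R) ^+ m.
  by apply/funext => k; rewrite /riemannR /= powR_mulrn// exprVn.
rewrite /zeta E; apply: nondecreasing_is_cvgn.
  by apply: nondecreasing_series => k _ _; rewrite exprn_ge0// invr_ge0.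
exists 2 => _ [N _ <-]; apply: le_trans (sum_invsq_le2 N).
by apply: ler_sum => k _; exact: invn_exp_le.
Qed.

Lemma is_cvg_dominated (a : nat -> R) (c : R) : 0 <= c ->
  (forall k, `|a k| <= c * (k.+1%:R^-1) ^+ 2) ->
  cvgn (fun N => \sum_(0 <= k < N) a k).
Proof.
move=> c0 ac; apply: normed_cvg.
apply: nondecreasing_is_cvgn; first by apply: nondecreasing_series => k _ _ /=.
exists (c * 2) => _ [N _ <-].
apply: (@le_trans _ _ (\sum_(0 <= k < N) c * (k.+1%:R^-1) ^+ 2)).
  by apply: ler_sum => k _; exact: ac.
by rewrite -mulr_sumr ler_wpM2l// sum_invsq_le2.
Qed.

(** The first term of the Taylor series of the logarithm at z / (k + 1) minus the
    logarithm itself; removing the linear part makes the sum over k converge. *)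
Definition log_defect z (k : nat) : R[i] := z * (k.+1%:R^-1)%:C - clog1p (z * (k.+1%:R^-1)%:C).
Definition log_defect_sum z N : R[i] := \sum_(0 <= k < N) log_defect z k.
(** This is log Gamma (1 + z) + gamma z near 0, see [Gamma_1D]. *)
Definition lgamma_tail z : R[i] := limn (log_defect_sum z).
Definition zeta_partial_sum z M : R[i] :=
  \sum_(2 <= m < M) (-1) ^+ m / m%:R * (zeta R m)%:C * z ^+ m.

Lemma normc_divn z k : normc (z * (k.+1%:R^-1)%:C) = normc z * k.+1%:R^-1.
Proof. by rewrite Normc.normcM normcR ger0_norm// invr_ge0. Qed.

Lemma normc_divn_le z k : normc (z * (k.+1%:R^-1)%:C) <= normc z.
Proof. by rewrite normc_divn ler_piMr ?normc_ge0// invf_le1// ler1n. Qed.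

Section SmallArgument.
Variable z : R[i].
Hypothesis z2 : normc z <= 1 / 2.

Let zk2 k : normc (z * (k.+1%:R^-1)%:C) <= 1 / 2.
Proof. exact: le_trans (normc_divn_le _ _) z2. Qed.

(** [clog1p_taylor] at z / (k + 1). Only the factor 1 / (k + 1)^2 of the remainder
    is kept: it suffices for summing over k, with a constant independent of M. *)
Lemma log_defect_taylor M k :
  normc (log_defect z k - \sum_(2 <= m < M.+2) (-1) ^+ m / m%:R * ((k.+1%:R^-1) ^+ m)%:C * z ^+ m)
  <= 4 * normc z ^+ M.+2 * (k.+1%:R^-1) ^+ 2.
Proof.
have -> : log_defect z k - \sum_(2 <= m < M.+2) (-1) ^+ m / m%:R * ((k.+1%:R^-1) ^+ m)%:C * z ^+ m
   = - (clog1p (z * (k.+1%:R^-1)%:C) - log_partial_sum (z * (k.+1%:R^-1)%:C) M.+1).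
  rewrite /log_defect; set w := z * _.
  have -> : \sum_(2 <= m < M.+2) (-1) ^+ m / m%:R * ((k.+1%:R^-1) ^+ m)%:C * z ^+ m = w - log_partial_sum w M.+1.
    rewrite /log_partial_sum big_ord_recl /= expr0 mul1r expr1 divr1 opprD addrA subrr add0r.
    rewrite -sumrN big_add1 big_add1 /= big_mkord; apply: eq_bigr => m _.
    rewrite /w exprMn rmorphXn /bump /= add1n.
    by rewrite [(-1) ^+ m.+2]exprS mulN1r; ring.
  ring.
rewrite normcN; apply: le_trans (clog1p_taylor M.+1 (zk2 k)) _.
rewrite -mulrA ler_wpM2l// normc_divn exprMn.
by rewrite ler_wpM2l ?exprn_ge0 ?normc_ge0// invn_exp_le.
Qed.

Lemma cvg_log_defect_sum : log_defect_sum z @ \oo --> lgamma_tail z.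
Proof.
have dk k : normc (log_defect z k) <= 4 * normc z ^+ 2 * (k.+1%:R^-1) ^+ 2.
  by have := log_defect_taylor 0 k; rewrite big_geq// subr0.
have c0 : 0 <= 4 * normc z ^+ 2 by rewrite mulr_ge0// exprn_ge0// normc_ge0.
have [h1 h2] : cvgn (fun N => \sum_(0 <= k < N) complex.Re (log_defect z k)) /\
   cvgn (fun N => \sum_(0 <= k < N) complex.Im (log_defect z k)).
  by split; apply: (is_cvg_dominated c0) => k; apply: le_trans (dk k);
    [exact: normr_Re_le|exact: normr_Im_le].
have h : log_defect_sum z @ \oo --> (limn (fun N => \sum_(0 <= k < N) complex.Re (log_defect z k)) +i*
    limn (fun N => \sum_(0 <= k < N) complex.Im (log_defect z k))).
  apply: cvg_complex; rewrite /log_defect_sum /=; under eq_fun do rewrite ?Re_sum ?Im_sum.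
    exact: h1.
  exact: h2.
by move: (h); rewrite -(cvgC_lim h).
Qed.

(** For a fixed M the sum over k of [log_defect_taylor] has a remainder of at most
    8 |z|^(M + 2) whatever the number of terms, and the main terms tend to
    values of zeta. *)
Lemma lgamma_tail_approx M :
  normc (lgamma_tail z - zeta_partial_sum z M.+2) <= 8 * normc z ^+ M.+2.
Proof.
pose S N := \sum_(2 <= m < M.+2) (-1) ^+ m / m%:R * (\sum_(0 <= k < N) (k.+1%:R^-1 : R) ^+ m)%:C * z ^+ m.
have cS : S @ \oo --> zeta_partial_sum z M.+2.
  rewrite /S /zeta_partial_sum big_add1 big_add1 /=.
  under eq_fun do rewrite big_add1 big_add1 /=.
  apply: (@cvgC_sum R _ \oo _ _ _ (fun m N => (-1) ^+ m.+2 / m.+2%:R * (\sum_(0 <= k < N) (k.+1%:R^-1 : R) ^+ m.+2)%:C * z ^+ m.+2)) => m.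
  apply: cvgC_M; last exact: cvgC_cst.
  apply: cvgC_M; first exact: cvgC_cst.
  apply: cvgC_real; exact: cvg_zeta.
have cN : (fun N => - S N) @ \oo --> - zeta_partial_sum z M.+2.
  rewrite -mulN1r; under eq_fun do rewrite -mulN1r.
  by apply: cvgC_M cS; exact: cvgC_cst.
apply: (cvg_normc_le (cvgC_D cvg_log_defect_sum cN)).
apply: nearW => N.
have -> : log_defect_sum z N + - S N = \sum_(0 <= k < N) (log_defect z k -
   \sum_(2 <= m < M.+2) (-1) ^+ m / m%:R * ((k.+1%:R^-1) ^+ m)%:C * z ^+ m).
  rewrite sumrB exchange_big /=; congr (_ - _); apply: eq_bigr => m _.
  by rewrite rmorph_sum mulr_sumr mulr_suml.
apply: le_trans (normc_sum _ _ _) _.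
apply: le_trans (ler_sum _ (fun k _ => log_defect_taylor M k)) _.
rewrite -mulr_sumr; apply: le_trans (ler_wpM2l _ (sum_invsq_le2 N)) _.
  by rewrite mulr_ge0// exprn_ge0// normc_ge0.
lra.
Qed.

Lemma cvg_zeta_partial_sum : zeta_partial_sum z @ \oo --> lgamma_tail z.
Proof.
have g : (fun M => 8 * (1 / 2) ^+ M : R) @ \oo --> (0 : R).
  by apply: cvg_geometric; rewrite ger0_norm; lra.
apply/cvg_normcP => e e0; move/cvgrPdist_le : g => /(_ _ e0) g.
near=> M.
have M2 : (2 <= M)%N by near: M; exists 2.
have gM : `|0 - 8 * (1 / 2) ^+ M : R| <= e by near: M; exact: g.
have ME : M = (M - 2).+2 by rewrite -addn2 subnK.
rewrite ME; apply: le_trans (lgamma_tail_approx _) _.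
rewrite -ME; apply: le_trans gM.
rewrite sub0r normrN ger0_norm ?mulr_ge0 ?exprn_ge0//.
by rewrite ler_wpM2l// lerXn2r ?nnegrE ?normc_ge0.
Unshelve. all: by end_near.
Qed.
End SmallArgument.

Lemma cvgC_X (T : Type) (F : set_system T) {FF : ProperFilter F} (f : T -> R[i])
  (l : R[i]) n : f @ F --> l -> (fun x => f x ^+ n) @ F --> l ^+ n.
Proof.
move=> fl; elim: n => [|n ih]; first by rewrite expr0; exact: cvgC_cst.
by rewrite exprS; under eq_fun do rewrite exprS; exact: cvgC_M.
Qed.

(** By [lgamma_tail_approx], [lgamma_tail] is a uniform limit of polynomials on
    the disc of radius 1/2. *)
Lemma cvg_lgamma_tail (T : Type) (F : set_system T) {FF : ProperFilter F}
  (f : T -> R[i]) (w : R[i]) : f @ F --> w -> normc w < 1 / 2 ->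
  (fun x => lgamma_tail (f x)) @ F --> lgamma_tail w.
Proof.
move=> fw w2; apply/cvg_normcP => e e0.
have e3 : 0 < e / 3 by rewrite divr_gt0.
have [M hM] : exists M, 8 * (1 / 2) ^+ M.+2 <= e / 3.
  have g : (fun M => 8 * (1 / 2) ^+ M : R) @ \oo --> (0 : R).
    by apply: cvg_geometric; rewrite ger0_norm; lra.
  move/cvgrPdist_le : g => /(_ _ e3) [M _ h]; exists M.
  have M2 : (M <= M.+2)%N by rewrite -addn2 leq_addr.
  by have := h _ M2; rewrite /= sub0r normrN ger0_norm // mulr_ge0// exprn_ge0.
have zM (z : R[i]) : normc z <= 1 / 2 ->
    normc (lgamma_tail z - zeta_partial_sum z M.+2) <= e / 3.
  move=> z2; apply: le_trans (lgamma_tail_approx z2 _) (le_trans _ hM).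
  by rewrite ler_wpM2l// lerXn2r ?nnegrE ?normc_ge0.
have pM : (fun x => zeta_partial_sum (f x) M.+2) @ F --> zeta_partial_sum w M.+2.
  apply: (@cvgC_sum R _ _ _ _ _ (fun m x => (-1) ^+ m / m%:R * (zeta R m)%:C * f x ^+ m)) => m.
  by apply: cvgC_M; [exact: cvgC_cst|exact: cvgC_X].
have d0 : 0 < 1 / 2 - normc w by rewrite subr_gt0.
move/cvg_normcP : pM => /(_ _ e3); move/cvg_normcP : (fw) => /(_ _ d0).
apply: filterS2 => x h1 h2.
have fx2 : normc (f x) <= 1 / 2.
  have -> : f x = w + - (w - f x) by ring.
  apply: le_trans (normc_triangle _ _) _; rewrite normcN; lra.
have -> : lgamma_tail w - lgamma_tail (f x) = (lgamma_tail w - zeta_partial_sum w M.+2)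
   + (zeta_partial_sum w M.+2 - zeta_partial_sum (f x) M.+2)
   + - (lgamma_tail (f x) - zeta_partial_sum (f x) M.+2) by ring.
apply: le_trans (normc_triangle _ _) _; rewrite normcN.
have := normc_triangle (lgamma_tail w - zeta_partial_sum w M.+2) (zeta_partial_sum w M.+2 - zeta_partial_sum (f x) M.+2).
have := zM _ fx2; have := zM _ (ltW w2); lra.
Qed.

Lemma lgamma_tail0 : lgamma_tail 0 = 0.
Proof.
have h : normc (0 : R[i]) <= 1 / 2 by rewrite Normc.normc0; lra.
have := lgamma_tail_approx h 0.
rewrite Normc.normc0 expr0n mulr0 /zeta_partial_sum big_geq// subr0 => h0.
by apply: Normc.eq0_normc; apply/eqP; rewrite eq_le h0 normc_ge0.
Qed.
End Zeta.

(** * Convergence of Gauss's limit and the functional equation *)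

Section GaussProduct.
Variable R : realType.
Implicit Types z w : R[i].

Definition harmonic_number N : R := \sum_(0 <= k < N) k.+1%:R^-1.

Lemma ln_le_harmonic_number N : ln (N.+1%:R : R) <= harmonic_number N.
Proof.
elim: N => [|N ih]; first by rewrite /harmonic_number big_geq// ln1.
rewrite /harmonic_number big_nat_recr//= -/(harmonic_number N) -lerBlDl.
apply: (le_trans (lerB (lexx _) ih)).
rewrite -ln_div ?posrE//.
have -> : N.+2%:R / N.+1%:R = 1 + N.+1%:R^-1 :> R.
  by field; rewrite gt_eqF // ltr_wpDr.
by apply: le_ln1Dx; rewrite (lt_trans (ltrN10 R)) ?invr_gt0.
Qed.

Lemma is_cvg_harmonic_number_ln : cvgn (fun N => harmonic_number N.+1 - ln (N.+1%:R : R)).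
Proof.
apply: nonincreasing_is_cvgn.
  apply/nonincreasing_seqP => N.
  rewrite [in leLHS]/harmonic_number big_nat_recr//= -/(harmonic_number N.+1).
  rewrite -addrA lerD2l.
  have h : ln (1 + - N.+2%:R^-1 : R) <= - N.+2%:R^-1.
    apply: le_ln1Dx; rewrite ltrN2 invf_lt1// ltr1n; by [].
  have E : 1 - N.+2%:R^-1 = N.+1%:R / N.+2%:R :> R.
    by field; rewrite gt_eqF // ltr_wpDr.
  rewrite E ln_div ?posrE// in h.
  by move: (ln _) (ln _) (_^-1) h => a b c h; lra.
exists 0 => _ [N _ <-]; rewrite subr_ge0.
apply: le_trans (ln_le_harmonic_number N.+1); rewrite ler_ln ?posrE// ler_nat; by [].
Qed.

Definition euler_gamma : R := limn (fun N => harmonic_number N.+1 - ln (N.+1%:R : R)).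

Lemma cpow_nat1D N z : cpow_nat N.+1 (1 + z) = N.+1%:R * cpow_nat N.+1 z.
Proof.
rewrite /cpow_nat mulrDl mul1r cexpD; congr (_ * _).
by rewrite /cexp /= cos0 sin0 mulr1 mulr0 lnK ?posrE// complexr0 rmorph_nat.
Qed.

Definition gauss_term z N : R[i] := N`!%:R * cpow_nat N z / rising z N.+1.

(** In the rising factorial at 1 + z, each factor k + z is k (1 + z / k), which
    extracts a factorial and leaves a product of exponentials of [clog1p]. *)
Lemma gauss_term_exp z N : normc z <= 1 / 2 ->
  gauss_term (1 + z) N.+1 = N.+1%:R / (N.+1%:R + 1 + z) *
    cexp (- z * (harmonic_number N.+1 - ln (N.+1%:R : R))%:C + log_defect_sum z N.+1).
Proof.
move=> z2; set n := N.+1.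
pose zk k : R[i] := z * (k.+1%:R^-1)%:C.
have zk1 k : cexp (clog1p (zk k)) = 1 + zk k.
  apply: cexp_clog1p.
  have := le_trans (normr_Re_le _) (le_trans (normc_divn_le z k) z2).
  rewrite ler_norml => /andP[h _]; apply: lt_le_trans h; lra.
have riseE : rising (1 + z) n.+1 =
    n`!%:R * (\prod_(0 <= k < n) (1 + zk k)) * (n%:R + 1 + z).
  rewrite /rising big_ord_recr /= -(big_mkord xpredT (fun k => 1 + z + k%:R)).
  congr (_ * _); last by ring.
  rewrite fact_prod big_add1 /= natr_prod -big_split /=; apply: eq_bigr => k _.
  have k0 : k.+1%:R != 0 :> R[i] by rewrite pnatr_eq0.
  rewrite /zk fmorphV rmorph_nat -natr1 in k0 *; field; by rewrite addrC.
have expE : cexp (- z * (harmonic_number n - ln (n%:R : R))%:C + log_defect_sum z n) =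
    cexp (z * (ln (n%:R : R))%:C) / \prod_(0 <= k < n) (1 + zk k).
  have -> : - z * (harmonic_number n - ln (n%:R : R))%:C + log_defect_sum z n
     = z * (ln (n%:R : R))%:C + - \sum_(0 <= k < n) clog1p (zk k).
    rewrite /log_defect_sum sumrB /harmonic_number rmorphB /= rmorph_sum /= -mulr_sumr; ring.
  rewrite cexpD cexpN cexp_sum; congr (_ / _); apply: eq_bigr => k _; exact: zk1.
rewrite /gauss_term riseE cpow_nat1D expE /cpow_nat -/n.
have f0 : n`!%:R != 0 :> R[i] by rewrite pnatr_eq0 -lt0n fact_gt0.
move: (\prod_(0 <= k < n) _) (cexp _) => P X.
rewrite [(n`!%:R * P * _)^-1]invfM [(n`!%:R * P)^-1]invfM.
rewrite [LHS](_ : _ = (n`!%:R / n`!%:R) * (n%:R / (n%:R + 1 + z) * (X / P))); last by ring.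
by rewrite divff// mul1r.
Qed.

Lemma cvgC_shiftS (f : nat -> R[i]) (l : R[i]) :
  (fun N => f N.+1) @ \oo --> l <-> f @ \oo --> l.
Proof. by rewrite -(@cvg_shiftS R[i]^o f (nbhs (l : R[i]))). Qed.

(** For |w| < N the error is |1 - N / (N + w)| = |w| / |N + w| <= |w| / (N - |w|). *)
Lemma cvg_natr_div w : (fun N => N.+1%:R / (N.+1%:R + w)) @ \oo --> (1 : R[i]).
Proof.
apply/cvg_normcP => e e0.
have w0 := normc_ge0 w.
have : \forall N \near \oo, normc w + normc w / e + 1 <= N%:R by exact: nbhs_infty_ger.
apply: filterS => N hN.
have N1 : normc w + normc w / e + 1 <= N.+1%:R :> R.
  by apply: le_trans hN _; rewrite ler_nat.
have hN1 : normc w / e + 1 <= normc (N.+1%:R + w).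
  have : normc (N.+1%:R : R[i]) = N.+1%:R.
    by rewrite -(rmorph_nat (real_complex R)) normcR ger0_norm.
  have := normc_triangle (N.+1%:R + w) (- w); rewrite addrK normcN.
  by move=> h1 h2; move: h1 N1; rewrite h2; lra.
have we : 0 <= normc w / e by rewrite divr_ge0// ltW.
have nw0 : 0 < normc (N.+1%:R + w) by apply: lt_le_trans hN1; rewrite ltr_wpDl.
have Nw0 : N.+1%:R + w != 0.
  by apply/eqP => E; move: nw0; rewrite E Normc.normc0 ltxx.
have -> : 1 - N.+1%:R / (N.+1%:R + w) = w / (N.+1%:R + w).
  by rewrite -{1}(divff Nw0) -mulrBl; congr (_ / _); ring.
rewrite Normc.normcM Normc.normcV ler_pdivrMr// mulrC -ler_pdivrMr//.
lra.
Qed.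

Lemma cvg_gauss_term1 z : normc z <= 1 / 2 ->
  gauss_term (1 + z) @ \oo --> cexp (- z * euler_gamma%:C + lgamma_tail z).
Proof.
move=> z2; apply/cvgC_shiftS; under eq_fun do rewrite gauss_term_exp//.
rewrite -[cexp (- z * euler_gamma%:C + _)]mul1r; apply: cvgC_M.
  under eq_fun do rewrite -addrA; exact: cvg_natr_div.
apply: cvgC_cexp; apply: cvgC_D.
  apply: cvgC_M; first exact: cvgC_cst.
  apply: cvgC_real; exact: is_cvg_harmonic_number_ln.
exact/(cvgC_shiftS (log_defect_sum z))/cvg_log_defect_sum.
Qed.

Lemma risingS z k : rising z k.+1 = rising z k * (z + k%:R).
Proof. by rewrite /rising big_ord_recr. Qed.

Lemma rising_recl z k : rising z k.+1 = z * rising (z + 1) k.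
Proof.
rewrite /rising big_ord_recl addr0; congr (_ * _); apply: eq_bigr => i _.
by rewrite lift0 -natr1; ring.
Qed.

Lemma gauss_term_succ z N : z != 0 ->
  gauss_term (z + 1) N.+1 = gauss_term z N.+1 * (z * (N.+1%:R / (N.+1%:R + (z + 1)))).
Proof.
move=> z0; rewrite /gauss_term.
have riseE : rising (z + 1) N.+2 = rising z N.+2 * (N.+1%:R + (z + 1)) / z.
  apply: (mulfI z0); rewrite -rising_recl risingS [RHS]mulrC divfK//.
  by congr (_ * _); rewrite -natr1; ring.
rewrite [X in cpow_nat _ X]addrC cpow_nat1D riseE !invfM invrK; ring.
Qed.

Lemma cvg_gauss_term_succ z l : z != 0 ->
  gauss_term z @ \oo --> l -> gauss_term (z + 1) @ \oo --> z * l.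
Proof.
move=> z0 zl; apply/cvgC_shiftS.
under eq_fun do rewrite gauss_term_succ//.
rewrite mulrC; apply: cvgC_M.
  exact/(cvgC_shiftS (gauss_term z)).
have h := cvgC_M (@cvgC_cst R _ \oo _ z) (cvg_natr_div (z + 1)).
rewrite [z * 1]mulr1 in h; exact: h.
Qed.

Lemma Gamma_1D z : normc z <= 1 / 2 ->
  Gamma (1 + z) = cexp (- z * euler_gamma%:C + lgamma_tail z).
Proof. move=> z2; exact: cvgC_lim (cvg_gauss_term1 z2). Qed.

(** The induction carries the convergence of the Gauss terms along with the value
    of the limit, since [Gamma] alone says nothing about convergence. *)
Lemma GammaDn z k : normc z <= 1 / 2 ->
  Gamma (1 + z + k%:R) = rising (1 + z) k * Gamma (1 + z).
Proof.
move=> z2; apply: cvgC_lim; elim: k => [|k ih].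
  rewrite addr0 /rising big_ord0 mul1r Gamma_1D//; exact: cvg_gauss_term1.
rewrite risingS -natr1 addrA [_ * (1 + z + _)]mulrC -mulrA.
apply: cvg_gauss_term_succ ih.
have := le_trans (normr_Re_le z) z2; rewrite ler_norml => /andP[h _].
apply/eqP => /(congr1 (@complex.Re R)).
rewrite -(rmorph_nat (real_complex R)) !ReD /=.
have := ler0n R k; lra.
Qed.
End GaussProduct.

(** * Gamma quotients *)

Section Quotient.
Variables (R : realType) (s : nat) (a : 'I_s -> nat) (e : 'I_s -> int).

Lemma normc_natM (n : nat) (u : R[i]) : normc (n%:R * u) = n%:R * normc u.
Proof. by rewrite Normc.normcM -(rmorph_nat (real_complex R)) normcR ger0_norm. Qed.

(** One neighbourhood of 0 serves for all i: the bound 1/4 leaves room for the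
    strict inequality that continuity requires. *)
Lemma near0_small : \forall u \near (0 : R[i]),
  normc u <= 1 / 4 /\ forall i, normc ((a i)%:R * u) <= 1 / 4.
Proof.
pose A : R := 1 + \sum_i (a i)%:R.
have A1 : 1 <= A by rewrite lerDl sumr_ge0.
have d0 : 0 < (4 * A)^-1 by rewrite invr_gt0 mulr_gt0//; lra.
move: (near0_normc d0); apply: filterS => u; rewrite invfM => uA.
have nu := normc_ge0 u.
have Au : A * normc u <= 1 / 4.
  have A0 : 0 < A by lra.
  by rewrite mulrC -ler_pdivlMr// mul1r.
split=> [|i]; first by apply: le_trans Au; rewrite ler_peMl.
rewrite normc_natM; apply: le_trans Au; rewrite ler_wpM2r//.
rewrite /A (bigD1 i)//= addrCA lerDl addr_ge0// sumr_ge0//.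
Qed.

(** Factor by factor, this is [GammaDn] with k = a_i n - 1: the last factor of
    (1 + a_i u)_(a_i n) is a_i (n + u) and cancels the denominator. *)
Lemma gamma_quotient_factor (p q : {poly R[i]}) (n : nat) (u : R[i]) :
  (forall i, (0 < a i)%N) -> (0 < n)%N -> normc u <= 1 / 2 ->
  (forall i, normc ((a i)%:R * u) <= 1 / 2) ->
  gamma_quotient a e p q (n%:R + u) = C_G a e u * K_G a e p q n u.
Proof.
move=> a0 n0 u2 au2.
have nu0 : n%:R + u != 0.
  apply/eqP => /(congr1 (@complex.Re R)).
  rewrite -(rmorph_nat (real_complex R)) ReD /=.
  have : 1 <= n%:R :> R by rewrite ler1n.
  have := le_trans (normr_Re_le u) u2; rewrite ler_norml => /andP[]; lra.
rewrite /gamma_quotient /C_G /K_G mulrCA -big_split /=; congr (_ * _).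
apply: eq_bigr => i _; rewrite -expfzMl; congr (_ ^ _).
have [k kE] : exists k, (a i * n)%N = k.+1.
  by exists (a i * n).-1; rewrite prednK// muln_gt0 a0.
have ai0 : (a i)%:R != 0 :> R[i] by rewrite pnatr_eq0 -lt0n.
have aE : (a i)%:R * (n%:R + u) = 1 + (a i)%:R * u + k%:R.
  by rewrite mulrDr -natrM kE -natr1; ring.
have au0 : (a i)%:R * (n%:R + u) != 0 by rewrite mulf_neq0.
by rewrite kE risingS -aE mulfK// aE GammaDn// mulrC.
Qed.

Definition log_C (u : R[i]) : R[i] :=
  \sum_i lgamma_tail ((a i)%:R * u) * (e i)%:~R.

(** The terms - gamma a_i u of the logarithms of the factors add up to a multiple
    of chi_1. *)
Lemma cexp_log_C u : chi a e 1 = 0 -> (forall i, normc ((a i)%:R * u) <= 1 / 2) ->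
  cexp (log_C u) = C_G a e u.
Proof.
move=> chi0 au2; rewrite /C_G.
transitivity (\prod_i cexp ((- ((a i)%:R * u) * (euler_gamma R)%:C + lgamma_tail ((a i)%:R * u)) *~ e i)); last first.
  by apply: eq_bigr => i _; rewrite cexpMz Gamma_1D.
rewrite -cexp_sum; congr cexp.
have : \sum_i (e i)%:~R * (a i)%:R = 0 :> R[i].
  have := congr1 (fun x : int => x%:~R : R[i]) chi0.
  rewrite /chi rmorph_sum /= mulr0z => h; rewrite -[RHS]h; apply: eq_bigr => i _.
  by rewrite expr1 rmorphM.
move=> h; under [RHS]eq_bigr do rewrite -mulrzr mulrDl.
rewrite big_split /= -/(log_C u).
rewrite [X in _ = X + _](_ : _ = - (u * (euler_gamma R)%:C) * \sum_i (e i)%:~R * (a i)%:R).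
  by rewrite h mulr0 add0r.
rewrite mulr_sumr; apply: eq_bigr => i _; ring.
Qed.

Lemma log_C_series u N :
  \sum_(2 <= m < N) (-1) ^+ m * ((chi a e m)%:~R / m%:R) * (zeta R m)%:C * u ^+ m
  = \sum_i zeta_partial_sum ((a i)%:R * u) N * (e i)%:~R.
Proof.
under [RHS]eq_bigr do rewrite /zeta_partial_sum mulr_suml.
rewrite exchange_big /=; apply: eq_bigr => m _.
rewrite /chi rmorph_sum /= mulr_suml mulr_sumr !mulr_suml; apply: eq_bigr => i _.
rewrite rmorphM rmorphXn /= exprMn; ring.
Qed.

Lemma cvg_log_C u : (forall i, normc ((a i)%:R * u) < 1 / 2) ->
  log_C @ u --> log_C u.
Proof.
move=> au2.
apply: (@cvgC_sum R _ (nbhs u) _ _ _ (fun i v => lgamma_tail ((a i)%:R * v) * (e i)%:~R)) => i.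
apply: cvgC_M; last exact: cvgC_cst.
apply: cvg_lgamma_tail; last exact: au2.
by apply: cvgC_M; [exact: cvgC_cst|exact: cvg_id].
Qed.

Lemma log_branch_log_C : chi a e 1 = 0 -> log_branch0 log_C (C_G a e).
Proof.
move=> chi0; split.
- by rewrite /log_C big1// => i _; rewrite mulr0 lgamma_tail0 mul0r.
- move: near0_small; apply: filterS => u [_ h]; apply: cvg_log_C => i.
  have := h i; lra.
- move: near0_small; apply: filterS => u [_ h]; apply: cexp_log_C => // i.
  have := h i; lra.
Qed.
End Quotient.

(** Two branches are close to 0 near 0, hence so is their difference, which is a
    logarithm of 1. *)
Lemma log_branch0_unique (R : realType) (L1 L2 f : R[i] -> R[i]) :
  log_branch0 L1 f -> log_branch0 L2 f ->
  \forall u \near (0 : R[i]), L1 u = L2 u.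
Proof.
case=> L10 /nbhs_singleton c1 e1 [L20 /nbhs_singleton c2 e2].
have half0 : 0 < 1 / 2 :> R by lra.
move/cvg_normcP : c1 => /(_ _ half0) c1; move/cvg_normcP : c2 => /(_ _ half0) c2.
near=> u.
have E1 : cexp (L1 u) = f u by near: u; exact: e1.
have E2 : cexp (L2 u) = f u by near: u; exact: e2.
have h1 : normc (L1 0 - L1 u) <= 1 / 2 by near: u; exact: c1.
have h2 : normc (L2 0 - L2 u) <= 1 / 2 by near: u; exact: c2.
rewrite L10 sub0r normcN in h1; rewrite L20 sub0r normcN in h2.
apply/eqP; rewrite -subr_eq0; apply/eqP; apply: cexp_eq1.
  rewrite cexpD cexpN E1 E2 divff// -E2; exact: cexp_neq0.
apply: le_trans (normr_Im_le _) _; apply: le_trans (normc_triangle _ _) _.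
by rewrite normcN; lra.
Unshelve. all: by end_near.
Qed.

Theorem lemma3p2 (R : realType) (s : nat) (a : 'I_s -> nat) (e : 'I_s -> int)
    (p q : {poly R[i]})
    (a_gt0 : forall i : 'I_s, (0 < a i)%N)
    (q_neq0 : q != 0) (coprime_pq : coprimep p q) :
  (forall n : nat, (0 < n)%N ->
     \forall u \near (0 : R[i]), q.[n%:R + u] != 0 ->
       gamma_quotient a e p q (n%:R + u) = C_G a e u * K_G a e p q n u)
  /\
  (chi a e 1 = 0 ->
     (exists L : R[i] -> R[i], log_branch0 L (C_G a e)) /\
     (forall L : R[i] -> R[i], log_branch0 L (C_G a e) ->
        \forall u \near (0 : R[i]),
          \sum_(2 <= m < N)
             (-1) ^+ m * ((chi a e m)%:~R / m%:R) * (zeta R m)%:C * u ^+ m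
            @[N --> \oo] --> L u)).
Proof.
split=> [n n0|chi0].
  move: (near0_small R a); apply: filterS => u [u4 au4] _.
  apply: gamma_quotient_factor => // [|i]; first lra.
  have := au4 i; lra.
have branch := log_branch_log_C R chi0; split; first by exists (log_C a e).
move=> L hL.
move: (log_branch0_unique hL branch) (near0_small R a).
apply: filterS2 => u -> [_ au4].
under eq_fun do rewrite log_C_series.
apply: (@cvgC_sum R _ _ _ _ _ (fun i N => zeta_partial_sum ((a i)%:R * u) N * (e i)%:~R)) => i.
apply: cvgC_M; last exact: cvgC_cst.
apply: cvg_zeta_partial_sum; have := au4 i; lra.
Qed.
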